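(* Let $G_c=(V,E)$ be a connected weighted communication graph on $n$ nodes with distinct node ids and edge weights that need not be distinct, let $T_a$ be a minimum spanning tree of $G_c$ (the initial aggregation tree), and let $v_f\in V$ be a faulty node such that the reduced communication graph $G'_c=(V',E')$, with $V'=V\setminus\{v_f\}$ and $E'=E\setminus\{\text{edges incident to } v_f\}$, is connected. Then the reconstructed aggregation tree $T_a'$ on the $n-1$ nodes of $V'$ that results from running the reconstruction algorithm (defined in the context) on $G_c$, $T_a$, $v_f$ is a minimum spanning tree of $G'_c$.
   Context: Edge weights are positive real communication costs (distances between sensor nodes); ties between edge weights are allowed. Reconstruction algorithm. Let $k$ be the degree of $v_f$ in $T_a$. Removing $v_f$ from $T_a$ leaves $k$ trees $T_1,\dots,T_k$, called clusters. The root of $T_i$ is initially its node that was adjacent to $v_f$ in $T_a$. At all times the id of a cluster is the id of its current root, so distinct clusters have distinct ids. The algorithm is synchronous and proceeds in rounds; each round consists of four subrounds. Subround I. Each cluster $T_i$ selects one minimum outgoing edge $\mathrm{moe}(T_i)$: an edge of $E'$ of minimum weight among all edges of $E'$ with exactly one endpoint in $T_i$. (Each node of the cluster finds its own minimum-weight edge leaving the cluster, ties at a single node being broken in favour of the smallest id of the other endpoint; the root then selects one edge of minimum weight among these, ties between different nodes being resolved arbitrarily.) If there is no outgoing edge, the algorithm terminates and the current tree is the output. Subround II. Each cluster $T_i$ sends a merge request along $\mathrm{moe}(T_i)$ to the cluster $T_j$ at its other end. If the id of $T_j$ is less than the id of $T_i$ the request is ignored; otherwise it is kept by $T_j$ (recorded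 at its root). Subround III. Each cluster sends exactly one merge message. If $T_j$ has kept at least one merge request, it sends its merge message to the cluster with minimum id among those whose requests it kept, along the edge on which that request arrived, and ignores the others. If $T_j$ has kept no request, it sends its merge message along $\mathrm{moe}(T_j)$. Subround IV. Suppose $T_i$ receives a merge message from $T_j$ along an edge $e$. (1) If $T_i$ also sent its merge message to $T_j$: if the id of $T_i$ is less than the id of $T_j$, then $T_i$ sends a commit message, $T_j$ merges with $T_i$ by including the edge $e$ in the tree, and the endpoints of $e$ start broadcasting over the new cluster a modify message carrying the root of $T_i$, which becomes the root (and gives the id) of the new cluster; if the id of $T_i$ is greater than the id of $T_j$, the received merge message is dropped. (2) If $T_i$ did not send its merge message to $T_j$: after $T_i$ has received a modify message from within its own cluster, it sends a commit message and forwards the modify message to $T_j$; then $T_j$ merges with $T_i$ by including the edge $e$ in the tree, and the nodes of $T_j$ adopt the root carried by the modify message. The algorithm is then repeated from Subround I with the resulting clusters, until termination. *)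

(* Defs.v *)
From mathcomp Require Import all_boot all_order all_algebra.
From mathcomp Require Import reals.
From Stdlib Require Export Relation_Operators.
Set Implicit Arguments.
Unset Strict Implicit.
Unset Printing Implicit Defensive.
Import Order.TTheory GRing.Theory Num.Theory.

(* An undirected edge is a two-element set of nodes; the nodes of a graph are
   a subset of an ambient finite type V, so that deleting a node does not
   change the type. *)
Record wgraph (V : finType) (R : realType) := WGraph {
  nodes : {set V};
  edges : {set {set V}};
  weight : {set V} -> R
}.

Definition well_formed (V : finType) (R : realType) (G : wgraph V R) : Prop :=
  forall e, e \in edges G ->
    [/\ e \subset nodes G, #|e| = 2 & (0 < weight G e)%R].

Definition delete_node (V : finType) (R : realType) (G : wgraph V R) (v : V) :
    wgraph V R :=
  WGraph (nodes G :\ v) [set e in edges G | v \notin e] (weight G).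

Definition adj (V : finType) (T : {set {set V}}) : rel V :=
  fun x y => [set x; y] \in T.

Definition connected_on (V : finType) (A : {set V}) (T : {set {set V}}) : Prop :=
  {in A &, forall x y, connect (adj T) x y}.

Definition connected_graph (V : finType) (R : realType) (G : wgraph V R) : Prop :=
  connected_on (nodes G) (edges G).

Definition acyclic (V : finType) (T : {set {set V}}) : Prop :=
  forall c : seq V, 2 < size c -> ~ ucycle (adj T) c.

Definition spanning_tree (V : finType) (R : realType) (G : wgraph V R)
    (T : {set {set V}}) : Prop :=
  [/\ T \subset edges G, connected_on (nodes G) T & acyclic T].

Definition is_mst (V : finType) (R : realType) (G : wgraph V R)
    (T : {set {set V}}) : Prop :=
  spanning_tree G T /\
  forall T', spanning_tree G T' ->
    (\sum_(e in T) weight G e <= \sum_(e in T') weight G e)%R.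

(* A forest whose nodes know the root of their cluster: the cluster with root r
   consists of the nodes x with [root s x = r], and is denoted by r. *)
Record forest (V : finType) := Forest {
  tree : {set {set V}};
  root : V -> V
}.

(* Each node of Ta - vf is rooted at the Ta-neighbour of vf in its component;
   the default value is only used at nodes outside Ta - vf. *)
Definition initial_forest (V : finType) (Ta : {set {set V}}) (vf : V) : forest V :=
  let F := [set e in Ta | vf \notin e] in
  Forest F (fun x => if [pick r | adj Ta vf r && connect (adj F) r x] is Some r
                     then r else x).

Section Round.
Variables (V : finType) (R : realType).
(* G is the reduced communication graph. *)
Variables (G : wgraph V R) (id : V -> nat) (s : forest V).

Definition clusters : {set V} := [set root s x | x in nodes G].

(* A directed edge (x, y) is one along which a message travels from x to y. *)
Definition edge_of (p : V * V) : {set V} := [set p.1; p.2].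

Definition outgoing (p : V * V) : bool :=
  (edge_of p \in edges G) && (root s p.1 != root s p.2).

(* p is the edge picked by the node p.1. *)
Definition node_moe (p : V * V) : Prop :=
  outgoing p /\
  forall z, outgoing (p.1, z) ->
    (weight G (edge_of p) < weight G (edge_of (p.1, z)))%R \/
    weight G (edge_of p) = weight G (edge_of (p.1, z)) /\ id p.2 <= id z.

(* p may be picked by the root of cluster r: several p may qualify. *)
Definition is_moe (r : V) (p : V * V) : Prop :=
  [/\ root s p.1 = r, node_moe p
    & forall q, root s q.1 = r -> node_moe q ->
        (weight G (edge_of p) <= weight G (edge_of q))%R].

Variable moe : V -> V * V.

Definition kept (j : V) : {set V} :=
  [set i in clusters | (root s (moe i).2 == j) && ~~ (id j < id i)].

(* The directed edge on which cluster j sends its merge message; a reply to a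
   kept request travels back along the edge of that request.  The pick fails
   only if no request was kept. *)
Definition merge_edge (j : V) : V * V :=
  if [pick i in kept j | [forall i' in kept j, id i <= id i']] is Some i
  then ((moe i).2, (moe i).1) else moe j.

Definition merge_target (j : V) : V := root s (merge_edge j).2.

End Round.

(* [Merging s moe cur M P] is a configuration reached once the merge messages
   of a round have been sent: s is the forest at the start of the round, moe
   gives the edges selected by its clusters, cur is the current forest, M is the
   set of nodes that have received a modify message in this round, and P is the
   set of clusters of s whose merge message has not yet been dealt with. *)
Inductive config (V : finType) :=
| RoundStart of forest V
| Merging of forest V & (V -> V * V) & forest V & {set V} & {set V}
| Terminated of {set {set V}}.
Arguments Terminated {V} _.

(* The choice of moe and the order in which merge and modify messages are
   handled are nondeterministic.  In the step_merge and step_drop rules, cluster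
   i handles the merge message that cluster j sent from its node b to the node a
   of i.  A cluster i that did not send its own merge message to j waits until
   a has received a modify message (step_merge_forward). *)
Inductive step (V : finType) (R : realType) (G : wgraph V R) (id : V -> nat) :
    config V -> config V -> Prop :=
| step_terminate s :
    (forall p, ~~ outgoing G s p) ->
    step G id (RoundStart s) (Terminated (tree s))
| step_select s moe :
    (exists p, outgoing G s p) ->
    (forall r, r \in clusters G s -> is_moe G id s r (moe r)) ->
    step G id (RoundStart s) (Merging s moe s set0 (clusters G s))
| step_merge_mutual s moe cur M (P : {set V}) i j a b :
    j \in P ->
    merge_edge G id s moe j = (b, a) ->
    merge_target G id s moe j = i ->
    merge_target G id s moe i = j ->
    id i < id j ->
    step G id (Merging s moe cur M P)
      (Merging s moe
        (Forest ([set a; b] |: tree cur)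
                (fun x => if x \in [set a; b] then i else root cur x))
        (M :|: [set a; b]) (P :\ j))
| step_drop_mutual s moe cur M (P : {set V}) i j :
    j \in P ->
    merge_target G id s moe j = i ->
    merge_target G id s moe i = j ->
    id j < id i ->
    step G id (Merging s moe cur M P) (Merging s moe cur M (P :\ j))
| step_merge_forward s moe cur (M P : {set V}) i j a b :
    j \in P ->
    merge_edge G id s moe j = (b, a) ->
    merge_target G id s moe j = i ->
    merge_target G id s moe i <> j ->
    a \in M ->
    step G id (Merging s moe cur M P)
      (Merging s moe
        (Forest ([set a; b] |: tree cur)
                (fun x => if x == b then root cur a else root cur x))
        (b |: M) (P :\ j))
| step_broadcast s moe cur (M P : {set V}) x y :
    x \in M -> y \notin M -> adj (tree cur) x y ->
    step G id (Merging s moe cur M P)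
      (Merging s moe
        (Forest (tree cur)
                (fun z => if z == y then root cur x else root cur z))
        (y |: M) P)
| step_next_round s moe cur (M : {set V}) :
    nodes G \subset M ->
    step G id (Merging s moe cur M set0) (RoundStart cur).

Definition reachable (V : finType) (R : realType) (G : wgraph V R)
    (id : V -> nat) : config V -> config V -> Prop :=
  clos_refl_trans (config V) (step G id).

(* Main.v *)
Require Import Defs.
From mathcomp Require Import all_boot all_order all_algebra.
From mathcomp Require Import reals.
From mathcomp Require Import zify.
Import Defs.
Set Implicit Arguments.
Unset Strict Implicit.
Unset Printing Implicit Defensive.
Import Order.TTheory GRing.Theory Num.Theory.

(* Call a forest F safe if no edge f of F has its endpoints connected by edges
   of G lighter than f together with other edges of F not heavier than f.  An
   exchange argument shows that a safe forest weighs at most as much as any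
   connected spanning subgraph, so a safe connected forest is a minimum spanning
   tree; conversely minimum spanning trees, and all their subsets, are safe.

   In a round, let f map a cluster to the cluster its merge message goes to.
   Comparing ids shows that every cycle of f has length 2 and that both messages
   of such a mutual pair travel along the same edge.  Hence the edges of the
   merge messages, added one at a time, either are already present or join
   different components, and each of them is the minimum outgoing edge of some
   cluster C.  Adding it preserves safety even with ties: consider the clusters
   that lead to C by added minimum outgoing edges of the same weight as that of
   C; every edge of smaller weight, and every other added edge of at most this
   weight, that meets this set of clusters stays within it.

   The modify messages spread the smaller id of the mutual pair that a cluster
   reaches under f.  If no message can be handled and no modify message can be
   forwarded, every cluster whose message has been handled has been covered
   completely, so a cluster whose target has been handled can merge. *)

(** * Connectivity, bridges and acyclicity of edge sets *)

Section Connectivity.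
Variable V : finType.
Implicit Types (A : {set V}) (S T : {set {set V}}) (x y u v : V).

Lemma connect_stable (e : rel V) (P : V -> Prop) x y :
  (forall u v, e u v -> P u -> P v) -> connect e x y -> P x -> P y.
Proof.
move=> eP /connectP[p]; elim: p x => [|z p IHp] x /= => [_ ->//|].
by case/andP=> exz pz yE Px; apply: (IHp z) => //; apply: eP exz Px.
Qed.

Lemma connect_exit (e : rel V) (A : {set V}) x y :
  connect e x y -> x \in A -> y \notin A ->
  exists u v, [/\ u \in A, v \notin A & e u v].
Proof.
case/connectP=> p; elim: p x => [|z p IHp] x /=.
  by move=> _ -> xA /negP.
case/andP=> exz pz yE xA yA.
by case: (boolP (z \in A)) => zA; [exact: IHp pz yE zA yA|exists x, z].
Qed.

Lemma adj_sym T : symmetric (adj T).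
Proof. by move=> x y; rewrite /adj setUC. Qed.

Lemma conn_sym T x y : connect (adj T) x y = connect (adj T) y x.
Proof. exact: (sym_connect_sym (@adj_sym T)). Qed.

Lemma conn_subset S T x y :
  S \subset T -> connect (adj S) x y -> connect (adj T) x y.
Proof.
move=> /subsetP sST; apply: connect_sub => u v uv.
by apply/connect1/sST.
Qed.

Lemma eq_set2 x y u v :
  [set x; y] = [set u; v] -> (x = u /\ y = v) \/ (x = v /\ y = u).
Proof.
move=> E; have := set21 x y; have := set22 x y.
have := set21 u v; have := set22 u v; rewrite E -{1 2}E !inE.
move=> /orP[]/eqP h1 /orP[]/eqP h2 /orP[]/eqP h3 /orP[]/eqP h4; subst; tauto.
Qed.

Lemma conn_set2 T x y u v :
  [set x; y] = [set u; v] -> connect (adj T) x y = connect (adj T) u v.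
Proof. by move=> /eq_set2[] [-> ->]; rewrite // conn_sym. Qed.

(** A walk that crosses the new edge a second time either repeats the crossing or is back on the
    side of [x], so one crossing suffices; [a] and [b] leave its direction open. *)
Lemma conn_add T u v x y :
  connect (adj ([set u; v] |: T)) x y ->
  connect (adj T) x y \/
  exists a b, [/\ [set a; b] = [set u; v], connect (adj T) x a & connect (adj T) b y].
Proof.
pose P z := connect (adj T) x z \/
  exists a b, [/\ [set a; b] = [set u; v], connect (adj T) x a & connect (adj T) b z].
move=> xy; apply: (connect_stable (P := P) _ xy); last by left; exact: connect0.
move=> z z'; rewrite /adj in_setU1 => /orP[/eqP E|zz'].
  case=> [xz|[a [b [ab xa bz]]]].
    by right; exists z, z'; split=> //; exact: connect0.
  case: (eq_set2 (etrans ab (esym E))) => [] [? ?]; subst.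
    by right; exists z, z'.
  by left.
case=> [xz|[a [b [ab xa bz]]]]; first by left; apply: connect_trans xz (connect1 _).
by right; exists a, b; split=> //; apply: connect_trans bz (connect1 _).
Qed.

Lemma acyclic_bridge T x y :
  acyclic T -> x != y -> [set x; y] \in T ->
  ~~ connect (adj (T :\ [set x; y])) x y.
Proof.
move=> acT xNy xyT; apply/negP=> /connectP[p0 p0P].
case/shortenP: p0P => p pP up _ yE.
case: p => [|z [|z' p]] in pP up yE *.
- by move: xNy; rewrite yE eqxx.
- by move: pP; rewrite yE /= /adj in_setD1 eqxx.
apply: (acT [:: x, z, z' & p]) => //; rewrite /ucycle up andbT /cycle.
rewrite rcons_path -yE; apply/andP; split; last by rewrite adj_sym.
by apply: sub_path pP => a b; rewrite /adj in_setD1 => /andP[].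
Qed.

(** A cycle without its first edge still joins the ends of that edge. *)
Lemma bridge_acyclic T :
  (forall x y, [set x; y] \in T -> ~~ connect (adj (T :\ [set x; y])) x y) ->
  acyclic T.
Proof.
move=> br [|x [|y [|z p]]] // _ /andP[].
rewrite /cycle rcons_path => /andP[/= /and3P[xy yz zp] lx].
rewrite !inE !negb_or => /and3P[/and3P[xNy xNz xp] /andP[yNz yp] up].
have /negP := br _ _ xy; apply; rewrite conn_sym.
apply/connectP; exists (rcons (z :: p) x); last by rewrite last_rcons.
rewrite rcons_path /=; rewrite -andbA; apply/and3P; split.
- rewrite /adj in_setD1 (yz : _ \in T) andbT; apply/eqP=> E.
  by have := set22 y z; rewrite E !inE eq_sym (negPf xNz) eq_sym (negPf yNz).
- apply/(pathP z) => i ip; rewrite /adj in_setD1 (pathP z zp i ip : _ \in T) andbT.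
  apply/eqP=> E; have := set21 x y; rewrite -E !inE.
  have xN t : t \in z :: p -> (x == t) = false.
    move=> tp; apply/negP=> /eqP xt; move: tp.
    by rewrite -xt inE (negPf xNz) (negPf xp).
  by rewrite xN ?xN ?mem_nth //= ?inE ?mem_nth ?orbT // ltnW.
- rewrite /adj in_setD1 (lx : _ \in T) andbT; apply/eqP=> E.
  have := set22 x y; rewrite -E !inE [y == x]eq_sym (negPf xNy) orbF => /eqP yl.
  by have := mem_last z p; rewrite -yl inE (negPf yNz) (negPf yp).
Qed.

End Connectivity.

(** * Safe forests and minimum spanning trees *)

Section SafeForests.
Variables (V : finType) (R : realType) (G : wgraph V R).
Hypothesis wfG : well_formed G.
Implicit Types (S T F H : {set {set V}}) (e f : {set V}) (x y u v : V).

Lemma edge_set2 e : e \in edges G ->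
  exists x y, [/\ e = [set x; y], x != y, x \in nodes G & y \in nodes G].
Proof.
case/wfG=> /subsetP eG /eqP /cards2P[x [y [xy eE]]] _.
by exists x, y; split; rewrite // eG // eE !inE eqxx ?orbT.
Qed.

Lemma edgeP x y : [set x; y] \in edges G ->
  [/\ x != y, x \in nodes G & y \in nodes G].
Proof.
case/wfG=> /subsetP eG c2 _; split; last 2 first; try by rewrite eG // !inE eqxx ?orbT.
by move: c2; rewrite cards2; case: eqP.
Qed.

(** Among the edges tied with [f] only those of [F] count: trading [f] for a tied edge outside [F]
    brings no gain. *)
Definition rivals F f : {set {set V}} :=
  [set g | (g \in edges G) && (weight G g < weight G f)%R
           || [&& g \in F, g != f & (weight G g <= weight G f)%R]].

(* For connected [G] and [F \subset edges G] this says that [F] extends to a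
   minimum spanning tree of [G]. *)
Definition safe F : Prop :=
  forall x y, [set x; y] \in F -> ~~ connect (adj (rivals F [set x; y])) x y.

Lemma safe_subset F F' : F' \subset F -> safe F -> safe F'.
Proof.
move=> /subsetP F'F sF x y xyF'; apply: contra (sF _ _ (F'F _ xyF')).
apply: conn_subset; apply/subsetP=> g; rewrite !inE.
by case/orP=> [->//|/and3P[/F'F -> -> ->]]; rewrite orbT.
Qed.

(** The new edge [e] matters only to an [f] of the same weight: a lighter [e] was a rival already, a
    heavier one never becomes one. For a tied [f], a connection through [e], closed up by [f], would
    join the ends of [e] by rivals of [e]. *)
Lemma safe_add F u v : [set u; v] \in edges G -> safe F ->
  ~~ connect (adj (rivals F [set u; v])) u v -> safe ([set u; v] |: F).
Proof.
move=> eG sF nuv; set e := [set u; v] in eG nuv *.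
case: (boolP (e \in F)) => [eF|eNF]; first by rewrite (setUidPr _) ?sub1set.
have rE f : rivals (e |: F) f =
  if (e != f) && (weight G e <= weight G f)%R then e |: rivals F f else rivals F f.
  apply/setP=> g; case: ifP => h; rewrite !inE; case: (eqVneq g e) => [->|] //=.
    by rewrite h orbT.
  by rewrite h (negPf eNF).
move=> x y; rewrite in_setU1 rE => /orP[/eqP xyE|xyF].
  by rewrite -xyE eqxx /= xyE (conn_set2 _ xyE).
have eNf : e != [set x; y] by apply: contraNneq eNF => ->.
rewrite eNf /=; case: ifP => wle; last exact: sF.
have [wlt|wge] := ltP (weight G e) (weight G [set x; y]).
  by rewrite (setUidPr _) ?sF // sub1set inE eG wlt.
have wE : weight G e = weight G [set x; y] by apply/le_anti; rewrite wle wge.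
apply/negP=> /conn_add[|[a [b [abE xa byP]]]]; first exact/negP/sF.
have sR : rivals F [set x; y] \subset rivals F e.
  apply/subsetP=> g; rewrite !inE wE.
  case/orP=> [->//|/and3P[gF _ ->]]; rewrite gF andbT /=.
  by rewrite (contraNneq _ eNF) ?orbT // => <-.
case/negP: nuv; rewrite -(conn_set2 _ abE) conn_sym.
apply: connect_trans (conn_subset sR byP) _; rewrite conn_sym.
apply: (connect_trans (y := x)); first by rewrite conn_sym (conn_subset sR).
by apply: connect1; rewrite /adj !inE xyF eq_sym eNf wge orbT.
Qed.

Lemma spanning_subtree T :
  T \subset edges G -> connected_on (nodes G) T ->
  exists2 S : {set {set V}}, S \subset T & spanning_tree G S.
Proof.
move=> TG cT.
pose P (S : {set {set V}}) :=
  [forall x in nodes G, forall y in nodes G, connect (adj S) x y].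
have PP (S : {set {set V}}) : reflect (connected_on (nodes G) S) (P S).
  apply: (iffP forall_inP) => [h x y xG yG|h x xG]; last first.
    by apply/forall_inP=> y yG; exact: h.
  by have /forall_inP := h x xG; exact.
have [S /minsetP[PS minS] sST] := minset_exists (introT (PP T) cT).
exists S => //; split; [exact: subset_trans sST TG|exact/PP|].
apply: bridge_acyclic => x y xyS; apply/negP=> xy.
suff /minS/(_ (subD1set _ _)) : P (S :\ [set x; y]).
  by move=> E; move: xyS; rewrite -E setD11.
apply/PP=> a b aG bG; have := elimT (PP S) PS a b aG bG.
apply: connect_sub => u v uv; case: (eqVneq [set u; v] [set x; y]) => [E|ne].
  by rewrite (conn_set2 _ E).
by apply: connect1; rewrite /adj in_setD1 ne.
Qed.

Lemma weight_subset S T : S \subset T -> T \subset edges G ->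
  (\sum_(e in S) weight G e <= \sum_(e in T) weight G e)%R.
Proof.
move=> sST /subsetP TG; rewrite [leRHS](big_setID S) /= (setIidPr sST) lerDl.
by apply: sumr_ge0 => e; rewrite inE => /andP[_ /TG/wfG[_ _ /ltW]].
Qed.

(** If rivals join the ends of [f], one of them crosses the cut left by removing [f] from [T]. It is
    not in [T], so it is strictly lighter than [f], and the swap gives a connected set lighter than
    [T]. *)
Lemma mst_safe T : is_mst G T -> safe T.
Proof.
case=> [[TG cT acT] minT] x y xyT; have xyG := subsetP TG _ xyT.
have [xNy xG yG] := edgeP xyG; apply/negP=> xy.
set f := [set x; y] in xyT xyG xy.
have [u [v [uvR nuv]]] :
    exists u v, [set u; v] \in rivals T f /\ ~~ connect (adj (T :\ f)) u v.
  have := acyclic_bridge acT xNy xyT; rewrite -/f => nxy.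
  case: (boolP [exists u, exists v,
      ([set u; v] \in rivals T f) && ~~ connect (adj (T :\ f)) u v]).
    by case/existsP=> u /existsP[v /andP[? ?]]; exists u, v.
  move=> no; case/negP: nxy; apply: connect_sub xy => u v uv.
  apply: contraNT no => nuv; apply/existsP; exists u; apply/existsP; exists v.
  by rewrite nuv andbT.
set e := [set u; v] in uvR.
have eNT : e \notin T :\ f by apply: contra nuv => ?; apply: connect1.
have /andP[eG we] : (e \in edges G) && (weight G e < weight G f)%R.
  move: uvR; rewrite inE => /orP[//|/and3P[eT ef _]].
  by rewrite in_setD1 eT ef in eNT.
have [_ uG vG] := edgeP eG.
have sT : T :\ f \subset e |: (T :\ f) := subsetUr _ _.
have TG' : e |: (T :\ f) \subset edges G.
  by rewrite subUset sub1set eG (subset_trans (subD1set _ _) TG).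
have [|S sS stS] := spanning_subtree TG'.
  move=> a b aG bG; apply: connect_sub (cT a b aG bG) => c d cd.
  case: (eqVneq [set c; d] f) => [E|ne]; last first.
    by apply: connect1; rewrite /adj !inE ne (cd : _ \in T) orbT.
  have : connect (adj (f |: (T :\ f))) u v by rewrite setD1K ?cT.
  case/conn_add=> [|[p [q [pq up qv]]]]; first by move/negP: nuv.
  rewrite (conn_set2 _ (etrans E (esym pq))).
  apply: (connect_trans (y := u)); first by rewrite conn_sym (conn_subset sT).
  apply: (connect_trans (y := v)); last by rewrite conn_sym (conn_subset sT).
  by apply: connect1; rewrite /adj setU11.
have := minT S stS; apply/negP; rewrite -ltNge.
apply: le_lt_trans (weight_subset sS TG') _.
by rewrite (big_setU1 _ eNT) (big_setD1 f xyT) /= ltrD2r.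
Qed.

(** Let [S] be maximal between [H] and [T] without connecting [x] to [y]. An edge of [T] outside
    [S], added to [S], connects them, so [[set x; y]] can stand in for it. *)
Lemma exchange T x y H :
  T \subset edges G -> connected_on (nodes G) T ->
  [set x; y] \in edges G -> H \subset T -> ~~ connect (adj H) x y ->
  exists2 e, e \in T :\: H & connected_on (nodes G) ([set x; y] |: (T :\ e)).
Proof.
move=> TG cT xyG HT nxy; have [_ xG yG] := edgeP xyG.
pose P S := (S \subset T) && ~~ connect (adj S) x y.
have [S /maxsetP[/andP[sST nS] maxS] sHS] :=
  @maxset_exists _ P _ (introT andP (conj HT nxy)).
have /subsetPn[e eT eNS] : ~~ (T \subset S).
  by apply: contra nS => /conn_subset; apply; apply: cT.
exists e; first by rewrite inE eT andbT (contra _ eNS) //; exact: (subsetP sHS).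
have sS : S \subset [set x; y] |: (T :\ e).
  by rewrite (subset_trans _ (subsetUr _ _)) // subsetD1 sST.
have [u [v [eE _ _ _]]] := edge_set2 (subsetP TG _ eT).
have : connect (adj (e |: S)) x y.
  apply: contraNT eNS => nxy'; rewrite -(maxS (e |: S)) ?setU11 ?subsetUr //.
  by rewrite /P nxy' subUset sub1set eT sST.
rewrite {1}eE => /conn_add[|[p [q [pq xp qy]]]]; first by move/negP: nS.
move=> a b aG bG; apply: connect_sub (cT a b aG bG) => c d cd.
case: (eqVneq [set c; d] e) => [E|ne]; last first.
  by apply: connect1; rewrite /adj !inE ne (cd : _ \in T) orbT.
rewrite (conn_set2 _ (etrans E (etrans eE (esym pq)))).
apply: (connect_trans (y := x)); first by rewrite conn_sym (conn_subset sS).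
apply: (connect_trans (y := y)); last by rewrite conn_sym (conn_subset sS).
by apply: connect1; rewrite /adj setU11.
Qed.

(** Among the lightest connected sets let [T2] share most edges with [F]. A missing [f] could be
    exchanged for a non-rival [e] of [T2]; minimality forces equal weights, so [e] is outside [F]
    and the overlap would grow. *)
Lemma safe_min F T :
  F \subset edges G -> safe F -> T \subset edges G -> connected_on (nodes G) T ->
  (\sum_(e in F) weight G e <= \sum_(e in T) weight G e)%R.
Proof.
move=> FG sF TG cT.
pose w (S : {set {set V}}) := (\sum_(e in S) weight G e)%R.
pose P S := (S \subset edges G) &&
  [forall x in nodes G, forall y in nodes G, connect (adj S) x y].
have PP (S : {set {set V}}) :
    reflect (S \subset edges G /\ connected_on (nodes G) S) (P S).
  apply: (iffP andP) => -[SG cS]; split=> //; [move=> x y xG yG|].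
    by have /forall_inP := forall_inP cS x xG; exact.
  by apply/forall_inP=> x xG; apply/forall_inP=> y yG; exact: cS.
have PT : P T by apply/PP.
case: (arg_minP w PT) => T1 PT1 minT1.
have Q1 : P T1 && (w T1 <= w T1)%R by rewrite PT1 lexx.
case: (@arg_maxnP _ T1 (fun S => P S && (w S <= w T1)%R) (fun S => #|S :&: F|) Q1).
move=> T2 /andP[/PP[T2G cT2] wT2] maxT2.
suff FT2 : F \subset T2.
  by apply: le_trans (weight_subset FT2 T2G) (le_trans wT2 (minT1 T PT)).
apply/subsetPn=> -[f fF fNT2].
have fG := subsetP FG _ fF; have [x [y [fE _ _ _]]] := edge_set2 fG.
rewrite fE in fG fF fNT2.
have /negP[] := sF _ _ fF.
set H := rivals F f.
apply: contraT; rewrite -fE -/H => nxy.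
have [||e] := @exchange T2 x y (T2 :&: H) T2G cT2 fG; first exact: subsetIl.
  by apply: contra nxy; apply: conn_subset; exact: subsetIr.
rewrite !inE -fE => /andP[h eT2]; rewrite eT2 /= negb_or in h => cT3.
have eG := subsetP T2G _ eT2; rewrite -fE in fNT2 fF fG.
have ef : e != f by apply: contraNneq fNT2 => <-.
have wfe : (weight G f <= weight G e)%R.
  by case/andP: h; rewrite eG /= -leNgt.
have PT3 : P (f |: (T2 :\ e)).
  by apply/PP; split=> //; rewrite subUset sub1set fG (subset_trans (subD1set _ _)).
have fN : f \notin T2 :\ e by rewrite in_setD1 negb_and fNT2 orbT.
have w3 : (w (f |: (T2 :\ e)) + weight G e = w T2 + weight G f)%R.
  by rewrite /w (big_setU1 _ fN) (big_setD1 e eT2) /=;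
    rewrite addrAC [RHS]addrAC (addrC (weight G f)).
have wef : (weight G e <= weight G f)%R.
  rewrite -(lerD2l (w T1)) (le_trans (lerD (minT1 _ PT3) (lexx _))) // w3.
  by rewrite lerD2r.
have eNF : e \notin F by apply: contraL h => eF; rewrite eF ef wef andbF.
have := maxT2 (f |: (T2 :\ e)); rewrite PT3 /=.
have -> : (w (f |: (T2 :\ e)) <= w T1)%R.
  by rewrite -(lerD2r (weight G e)) w3 lerD.
move=> /(_ isT); rewrite /geq /= leqNgt => /negP[].
have -> : (f |: (T2 :\ e)) :&: F = f |: (T2 :&: F).
  apply/setP=> g; rewrite !inE; case: (eqVneq g f) => [->|_] //=.
  by case: (eqVneq g e) => [->|_] //=; rewrite (negPf eNF) andbF.
by rewrite cardsU1 inE (negPf fNT2).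
Qed.

(** For acyclicity: dropping a redundant edge would leave a connected set of smaller weight, as
    weights are positive. *)
Lemma safe_connected_mst T :
  T \subset edges G -> connected_on (nodes G) T -> safe T -> is_mst G T.
Proof.
move=> TG cT sT; split; last by move=> T' [T'G cT' _]; exact: safe_min.
split=> //; apply: bridge_acyclic => x y xyT; apply/negP=> xy.
have cD : connected_on (nodes G) (T :\ [set x; y]).
  move=> a b aG bG; apply: connect_sub (cT a b aG bG) => u v uv.
  case: (eqVneq [set u; v] [set x; y]) => [E|ne].
    by rewrite (conn_set2 _ E).
  by apply: connect1; rewrite /adj in_setD1 ne.
have := safe_min TG sT (subset_trans (subD1set _ _) TG) cD.
apply/negP; rewrite -ltNge (big_setD1 _ xyT) /= ltrDr.
by have [_ _] := wfG (subsetP TG _ xyT).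
Qed.

End SafeForests.

(** * One round: merge messages as a map between clusters *)

Section OneRound.
Variables (V : finType) (R : realType) (G : wgraph V R) (id : V -> nat).
Hypothesis wfG : well_formed G.
Hypothesis id_inj : {in nodes G &, injective id}.
Implicit Types (F S : {set {set V}}) (X : {set V}) (p q : V * V).

(** By the last two clauses, nodes of [G] have equal roots exactly when [tree s] connects them. *)
Definition valid_forest (s : forest V) : Prop :=
  [/\ tree s \subset edges G, safe G (tree s),
      {in nodes G, forall x,
        root s x \in nodes G /\ connect (adj (tree s)) x (root s x)}
    & forall x y, adj (tree s) x y -> root s x = root s y].

Variable s : forest V.
Hypothesis vs : valid_forest s.

Lemma outgoingP p : outgoing G s p ->
  [/\ p.1 \in nodes G, p.2 \in nodes G & root s p.1 != root s p.2].
Proof. by case/andP=> /(edgeP wfG)[_ ? ?]. Qed.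

Lemma root_cluster x : x \in nodes G -> root s x \in clusters G s.
Proof. exact: imset_f. Qed.

Lemma cluster_node D : D \in clusters G s -> D \in nodes G.
Proof. by case/imsetP=> x xG ->; have [_ _ /(_ x xG)[]] := vs. Qed.

Lemma cluster_id_inj D D' : D \in clusters G s -> D' \in clusters G s ->
  id D = id D' -> D = D'.
Proof. by move=> /cluster_node ? /cluster_node ?; exact: id_inj. Qed.

Lemma node_moe_exists x z : outgoing G s (x, z) ->
  exists2 y, node_moe G id s (x, y)
    & (weight G (edge_of (x, y)) <= weight G (edge_of (x, z)))%R.
Proof.
move=> oxz; pose w y := weight G (edge_of (x, y)).
case: (@arg_minP _ _ _ z (fun y => outgoing G s (x, y)) w oxz) => y1 oy1 min1.
have Q1 : outgoing G s (x, y1) && (w y1 <= w y1)%R by rewrite oy1 lexx.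
case: (@arg_minnP _ y1 (fun y => outgoing G s (x, y) && (w y <= w y1)%R) id Q1).
move=> y2 /andP[oy2 w2] min2; exists y2; last by apply: le_trans w2 (min1 _ oxz).
split=> // t ot; have wt := min1 t ot.
have [lt|ge] := ltP (w y2) (w t); first by left.
have wE : w y2 = w t by apply/le_anti; rewrite ge (le_trans w2).
by right; split; first exact: wE; apply: min2; rewrite ot (le_trans ge).
Qed.

Lemma is_moe_exists r p : outgoing G s p -> root s p.1 = r ->
  exists q, is_moe G id s r q.
Proof.
move=> op rp; pose w p := weight G (edge_of p).
have Qp : outgoing G s p && (root s p.1 == r) by rewrite op rp eqxx.
case: (@arg_minP _ _ _ p (fun p => outgoing G s p && (root s p.1 == r)) w Qp).
move=> [x z] /andP[oxz /eqP rx] min1.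
have [y xy wy] := node_moe_exists oxz; exists (x, y); split=> // q rq [oq _].
by apply: le_trans wy (min1 _ _); rewrite oq rq eqxx.
Qed.

Variable moe : V -> V * V.
Hypothesis moeP : forall r, r \in clusters G s -> is_moe G id s r (moe r).

Notation cl := (clusters G s).
Notation kept := (kept G id s moe).
Notation merge_edge := (merge_edge G id s moe).
Notation target := (merge_target G id s moe).

Lemma moe_outgoing D : D \in cl -> outgoing G s (moe D) /\ root s (moe D).1 = D.
Proof. by case/moeP=> ? [? _] _. Qed.

Lemma moe_min D p : D \in cl -> outgoing G s p -> root s p.1 = D ->
  (weight G (edge_of (moe D)) <= weight G (edge_of p))%R.
Proof.
case/moeP=> _ _ minD; case: p => x z oxz rx.
by have [y xy wy] := node_moe_exists oxz; apply: le_trans (minD (x, y) rx xy) wy.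
Qed.

Lemma keptP i j : j \in cl ->
  i \in kept j -> [/\ i \in cl, root s (moe i).2 = j & id i < id j].
Proof.
move=> jc; rewrite inE => /and3P[ic /eqP tj]; rewrite -leqNgt leq_eqVlt.
case/orP=> [/eqP/(cluster_id_inj ic jc) ij|-> //].
have [/outgoingP[_ _]] := moe_outgoing ic.
by rewrite tj => h E; rewrite E ij eqxx in h.
Qed.

Lemma request_kept i j : i \in cl -> root s (moe i).2 = j -> id i < id j ->
  i \in kept j.
Proof. by move=> ic tj ij; rewrite inE ic tj eqxx -leqNgt ltnW. Qed.

Variant merge_spec j : Prop :=
| Reply i of i \in kept j & merge_edge j = ((moe i).2, (moe i).1) & target j = i
| Request of kept j = set0 & merge_edge j = moe j & target j = root s (moe j).2.

Lemma mergeP j : j \in cl -> merge_spec j.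
Proof.
move=> jc; have: merge_edge j = merge_edge j by [].
rewrite {2}/Defs.merge_edge; case: pickP => [i /andP[ik _] mE|none mE].
  have [ic _ _] := keptP jc ik; have [_ ri] := moe_outgoing ic.
  by apply: (Reply ik mE); rewrite /merge_target mE.
apply: (Request _ mE); last by rewrite /merge_target mE.
apply/eqP; apply: contraT => /set0Pn[i ik].
case: (@arg_minnP _ i (fun i => i \in kept j) id ik) => i' ik' min.
by have /negP[] := none i'; rewrite ik'; apply/forall_inP.
Qed.

Lemma merge_outgoing j : j \in cl ->
  [/\ outgoing G s (merge_edge j), root s (merge_edge j).1 = j,
      target j \in cl & target j != j].
Proof.
move=> jc; suff [oj rj] : outgoing G s (merge_edge j) /\ root s (merge_edge j).1 = j.
  have [_ n2 ne] := outgoingP oj; split=> //; first exact: root_cluster.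
  by rewrite /merge_target -{2}rj eq_sym.
case: (mergeP jc) => [i ik -> _|_ -> _]; last exact: moe_outgoing.
have [ic ti _] := keptP jc ik; have [/andP[o1 o2] ri] := moe_outgoing ic.
split; last exact: ti.
by rewrite /outgoing /edge_of setUC o1 eq_sym.
Qed.

Lemma target_cluster j : j \in cl -> target j \in cl.
Proof. by case/merge_outgoing. Qed.

Lemma iter_target_cluster k j : j \in cl -> iter k target j \in cl.
Proof. by move=> jc; elim: k => //= k; exact: target_cluster. Qed.

(** Replies go to smaller ids, so the two clusters do not both reply; if neither did, the one of
    larger id would have kept the request of the other. So exactly one replies, along the edge of
    the other's request. *)
Lemma mutual_edge j : j \in cl -> target (target j) = j ->
  edge_of (merge_edge (target j)) = edge_of (merge_edge j).
Proof.
move=> jc; have [_ _ tc tj] := merge_outgoing jc.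
case: (mergeP jc) => [i ik mj tjE|k0 mj tjE] ttj.
  rewrite mj tjE in ttj *; have [ic ti ij] := keptP jc ik.
  case: (mergeP ic) => [i' ik' _ E|_ -> _]; last by rewrite /edge_of /= setUC.
  have [_ _] := keptP ic ik'; rewrite -E ttj => ji.
  by have := ltn_trans ij ji; rewrite ltnn.
case: (mergeP tc) => [i ik -> E|k0' mi E].
  by rewrite ttj in E; rewrite -E mj /edge_of setUC.
have [lt|gt|/(cluster_id_inj tc jc)/eqP] := ltngtP (id (target j)) (id j).
- by have := request_kept tc (esym (etrans (esym ttj) E)) lt; rewrite k0 inE.
- by have := request_kept jc (esym tjE) gt; rewrite k0' inE.
- by rewrite (negPf tj).
Qed.

(* A cluster that replies has a target of smaller id that either replies in
   turn or sends its message back. *)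
Lemma reaches_mutual j : j \in cl ->
  exists k, target (target (iter k target j)) = iter k target j.
Proof.
pose Q j := exists k, target (target (iter k target j)) = iter k target j.
have Qstep i : Q (target i) -> Q i by case=> k; rewrite -iterSr; exists k.+1.
have Qreply i : i \in cl -> kept i != set0 -> Q i.
  have [n] := ubnP (id i); elim: n i => // n IHn i le_n ic.
  case: (mergeP ic) => [i' ik' _ tE _|->]; last by rewrite eqxx.
  have [ic' ti' lti'] := keptP ic ik'.
  case: (mergeP ic') => [i2 ik2 _ t2E|k0 _ t2E]; last first.
    by exists 0; rewrite /= tE t2E.
  apply: Qstep; rewrite tE; apply: IHn => //; first exact: leq_trans lti' _.
  by apply/set0Pn; exists i2.
rewrite -/(Q j); have [n] := ubnP (id j); elim: n j => // n IHn j le_n jc.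
case: (mergeP jc) => [i ik _ _|_ _ tE].
  by apply: Qreply => //; apply/set0Pn; exists i.
apply: Qstep; have [_ _ tc tj] := merge_outgoing jc.
have [lt|gt|/(cluster_id_inj tc jc)/eqP] := ltngtP (id (target j)) (id j).
- by apply: IHn => //; exact: leq_trans lt _.
- by apply: Qreply => //; apply/set0Pn; exists j; apply: request_kept.
- by rewrite (negPf tj).
Qed.

Lemma target_cycle k j : j \in cl -> iter k.+1 target j = j ->
  target (target j) = j.
Proof.
move=> jc jE; have [m mE] := reaches_mutual jc.
have it n : iter (n * k.+1) target j = j.
  by elim: n => // n IHn; rewrite mulSn iterD IHn.
have per d : target (target (iter (d + m) target j)) = iter (d + m) target j.
  by elim: d => //= d ->.
(* Mutuality persists from iterate [m] on, and [m * k.+1] is a multiple of the period that is at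
   least [m]. *)
by have := per (m * k.+1 - m); rewrite subnK ?leq_pmulr // it.
Qed.

(** These are the clusters whose own merge message is dropped and whose root the merged cluster
    adopts. *)
Definition small j : bool := (target (target j) == j) && (id j < id (target j)).

(* The root that all clusters merging with [j] end up with. *)
Definition new_root j : V := odflt j [pick c | fconnect target j c && small c].

Lemma new_root_small j : j \in cl ->
  fconnect target j (new_root j) /\ small (new_root j).
Proof.
move=> jc; rewrite /new_root; case: pickP => [c /andP[] //|none].
have [k kE] := reaches_mutual jc; set c := iter k target j in kE.
have cc : c \in cl by exact: iter_target_cluster.
have [_ _ tc tj] := merge_outgoing cc.
have jc' : fconnect target j c := fconnect_iter _ _ _.
have [lt|gt|/(cluster_id_inj tc cc)/eqP] := ltngtP (id (target c)) (id c).
- have := none (target c); rewrite /small kE eqxx lt andbT.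
  by rewrite (connect_trans jc') ?fconnect1.
- by have := none c; rewrite /small kE eqxx gt jc'.
- by rewrite (negPf tj).
Qed.

(** Both picks range over the same candidates: starting one step later could lose only [j] itself,
    and a small [j] is reached again from its target. *)
Lemma new_root_target j : j \in cl -> new_root (target j) = new_root j.
Proof.
move=> jc; have [jr sr] := new_root_small jc.
have E c : fconnect target (target j) c && small c = fconnect target j c && small c.
  apply/andP/andP=> -[jc' sc]; split=> //.
    exact: connect_trans (fconnect1 _ _) jc'.
  move: jc'; rewrite fconnect_eqVf => /orP[/eqP ->|//].
  by case/andP: sc => /eqP cc _; have := fconnect1 target (target c); rewrite cc.
rewrite /new_root -(eq_pick E); case: pickP => // none.
by have := none (new_root j); rewrite E jr sr.
Qed.

(** The orbit of a small [j] consists of [j] and [target j], and the latter is not small. *)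
Lemma new_root_of_small j : j \in cl -> small j -> new_root j = j.
Proof.
move=> jc sj; have [/iter_findex] := new_root_small jc.
set k := findex _ _ _; case/andP: sj => /eqP jj lt.
have : iter k target j = j \/ iter k target j = target j.
  by elim: k => [|k [] /= ->]; rewrite ?jj; auto.
case=> -> // E; rewrite /small -E jj eqxx /= => gt.
by have := ltn_trans lt gt; rewrite ltnn.
Qed.

(** * One round: the edges added by merge messages *)

Definition merged X : {set {set V}} :=
  tree s :|: [set edge_of (merge_edge D) | D in X].

Lemma mem_merged X e : e \in merged X ->
  e \in tree s \/ exists2 D, D \in X & e = edge_of (merge_edge D).
Proof. by case/setUP=> [|/imsetP]; auto. Qed.

Lemma merge_edge_merged X D : D \in X -> edge_of (merge_edge D) \in merged X.
Proof.
move=> DX; apply/setUP; right.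
exact: (imset_f (fun D => edge_of (merge_edge D))).
Qed.

Lemma merged_edges X : X \subset cl -> merged X \subset edges G.
Proof.
move=> /subsetP Xc; apply/subsetP=> e /mem_merged[|[D /Xc Dc ->]].
  by have [/subsetP sG _ _ _] := vs; exact: sG.
by have [/andP[]] := merge_outgoing Dc.
Qed.

(* The clusters that lead to [j] by merge messages of [X] form a union of
   components of [merged X]. *)
Lemma merged_new X j : X \subset cl -> j \in cl -> j \notin X ->
  edge_of (merge_edge j) \notin merged X ->
  ~~ connect (adj (merged X)) (merge_edge j).1 (merge_edge j).2.
Proof.
move=> /subsetP Xc jc jX eNX; have [_ rj tc tj] := merge_outgoing jc.
pose nx := [rel D D' | (D \in X) && (target D == D')].
have nx_target D : connect nx D j -> D != j -> D \in X /\ connect nx (target D) j.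
  case/connectP=> [[|D' p] /=]; first by move=> _ ->; rewrite eqxx.
  by case/andP=> /andP[DX /eqP ->] pp -> _; split=> //; apply/connectP; exists p.
apply/negP=> cn; have : connect nx (target j) j.
  (* Tree edges stay within a cluster, and a cluster of [X], being different from [j], leads to [j]
     exactly when its target does. *)
  apply: (connect_stable (P := fun z => connect nx (root s z) j) _ cn).
    move=> u v /mem_merged[uv|[D DX /eq_set2[] [-> ->]]].
    - by have [_ _ _ /(_ _ _ uv) ->] := vs.
    - have [_ -> _ _] := merge_outgoing (Xc _ DX); case/nx_target=> //.
      by apply: contraNneq jX => <-.
    - have [_ -> _ _] := merge_outgoing (Xc _ DX).
      by apply: connect_trans; apply: connect1; rewrite /= DX eqxx.
  by rewrite rj connect0.
move=> nj; have [tX _] := nx_target _ nj tj.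
(* Now [j] lies on a cycle of [target], hence in a mutual pair, and its partner in [X] has already
   added the same edge. *)
have /iter_findex : fconnect target (target j) j.
  by apply: connect_sub nj => D D' /andP[_ DD']; apply: connect1.
rewrite -iterSr => /(target_cycle jc) ttj.
by case/negP: eNX; rewrite -(mutual_edge jc ttj) merge_edge_merged.
Qed.

Lemma merge_edge_moe j : j \in cl ->
  exists2 C, C \in cl & edge_of (merge_edge j) = edge_of (moe C).
Proof.
move=> jc; case: (mergeP jc) => [i ik -> _|_ -> _]; last by exists j.
by have [ic _ _] := keptP jc ik; exists i; rewrite // /edge_of setUC.
Qed.

(* Every edge leaving a cluster that leads to [C] by minimum outgoing edges of
   weight [W = weight G (edge_of (moe C))] in [F] has weight at least [W], and
   those in [F] of weight [W] lead to such clusters again. *)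
Lemma moe_cut F C : C \in cl -> tree s \subset F -> F \subset edges G ->
  (forall e, e \in F -> e \in tree s \/ exists2 D, D \in cl & e = edge_of (moe D)) ->
  edge_of (moe C) \notin F ->
  ~~ connect (adj F) (moe C).1 (moe C).2 ->
  ~~ connect (adj (rivals G F (edge_of (moe C)))) (moe C).1 (moe C).2.
Proof.
move=> Cc sF /subsetP FG Fmoe eNF nF; have [oC rC] := moe_outgoing Cc.
set W := weight G (edge_of (moe C)).
pose nx := [rel D D' | [&& D \in cl, weight G (edge_of (moe D)) == W,
  edge_of (moe D) \in F & root s (moe D).2 == D']].
have inF x y : connect (adj (tree s)) x y -> connect (adj F) x y.
  exact: conn_subset.
have [_ _ rootP adjR] := vs.
have conn_own x : x \in nodes G -> connect (adj F) x (root s x).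
  by case/rootP=> _ /inF.
have nx_step D : connect nx D C -> D != C -> [/\ D \in cl,
    weight G (edge_of (moe D)) = W & connect nx (root s (moe D).2) C].
  case/connectP=> [[|D' p] /=]; first by move=> _ ->; rewrite eqxx.
  case/andP=> /and4P[Dc /eqP DW _ /eqP ->] pp -> _; split=> //.
  by apply/connectP; exists p.
apply: contra nF => cn; have [n1 n2 _] := outgoingP oC.
have : connect nx (root s (moe C).2) C.
  apply: (connect_stable (P := fun z => connect nx (root s z) C) _ cn); last first.
    by rewrite rC connect0.
  move=> u v uvR uC; case: (eqVneq (root s u) (root s v)) => [<- //|ruv].
  have uvG : [set u; v] \in edges G.
    by move: uvR; rewrite /adj inE => /orP[/andP[]|/and3P[/FG]].
  have ouv : outgoing G s (u, v) by rewrite /outgoing uvG.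
  (* The cluster of [u] is [C] or one on a chain to [C]; either way its minimum outgoing edge has
     weight [W]. *)
  have Wuv : (W <= weight G [set u; v])%R.
    case: (eqVneq (root s u) C) => [E|ne]; first exact: (moe_min Cc ouv E).
    by have [Dc <- _] := nx_step _ uC ne; exact: (moe_min Dc ouv erefl).
  move: uvR; rewrite /adj inE uvG ltNge Wuv /= => /and3P[uvF uvNe uvW].
  have wE : weight G [set u; v] = W by apply/le_anti; rewrite uvW Wuv.
  case: (Fmoe _ uvF) => [/adjR E|[D Dc DE]]; first by rewrite E eqxx in ruv.
  have [_ rD] := moe_outgoing Dc.
  (* If [D] is the cluster of [u], the edge is the first link of its chain to [C]; if [D] is that of
     [v], the edge extends the chain from [u] by one link. *)
  case: (eq_set2 DE) => -[uE vE].
    rewrite uE rD in uC; rewrite vE; case/nx_step: uC => //.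
    by apply: contraNneq uvNe => <-; rewrite DE.
  apply: connect_trans (connect1 _) uC.
  by rewrite /= vE rD Dc -DE wE eqxx uvF uE eqxx.
(* The links of the chain from the far end back to [C] are edges of [F], so [F] already connects the
   ends of [moe C]. *)
move=> vC; rewrite conn_sym; suff : connect (adj F) (moe C).2 C.
  by move/connect_trans; apply; rewrite -{1}rC conn_sym conn_own.
apply: (connect_stable (P := connect (adj F) (moe C).2) _ vC); last exact: conn_own.
move=> D D' /= /and4P[Dc _ DF /eqP <-] cD; have [oD rD] := moe_outgoing Dc.
have [m1 m2 _] := outgoingP oD; apply: connect_trans cD _.
apply: (connect_trans (y := (moe D).1)); first by rewrite -{1}rD conn_sym conn_own.
by apply: connect_trans (conn_own _ m2); apply: connect1.
Qed.

Lemma merged_safe X : X \subset cl -> safe G (merged X).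
Proof.
have [n] := ubnP #|X|; elim: n X => // n IHn X leX Xc.
case: (set_0Vmem X) => [X0|[j jX]].
  have [_ sT _ _] := vs; apply: safe_subset sT.
  apply/subsetP=> e /mem_merged[//|[D]]; by rewrite X0 inE.
have jc := subsetP Xc _ jX; pose X' := X :\ j.
have X'c : X' \subset cl := subset_trans (subD1set _ _) Xc.
have sX' : safe G (merged X').
  by apply: IHn X'c; move: leX; rewrite (cardsD1 j) jX.
have mE : merged X = edge_of (merge_edge j) |: merged X'.
  by rewrite /merged -{1}(setD1K jX) imsetU1 setUCA.
(* The partner of [j] in a mutual pair may have contributed this edge already. *)
rewrite mE; case: (boolP (edge_of (merge_edge j) \in merged X')) => eX'.
  by rewrite (setUidPr _) ?sub1set.
have [C Cc CE] := merge_edge_moe jc.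
have := merged_new X'c jc _ eX'; rewrite setD11 (conn_set2 _ CE) => /(_ isT) nC.
rewrite CE in eX' *; apply: safe_add => //.
  by have [/andP[]] := moe_outgoing Cc.
apply: moe_cut => //; first exact: subsetUl.
  exact: merged_edges.
move=> e /mem_merged[|[D DX' ->]]; first by left.
by right; apply: merge_edge_moe (subsetP X'c _ DX').
Qed.

Lemma merged_root X x y : X \subset cl -> adj (merged X) x y ->
  new_root (root s x) = new_root (root s y).
Proof.
move=> /subsetP Xc /mem_merged[|[D /Xc Dc /eq_set2[] [-> ->]]].
- by have [_ _ _ adjR /adjR ->] := vs.
- by have [_ -> _ _] := merge_outgoing Dc; rewrite -new_root_target.
- by have [_ -> _ _] := merge_outgoing Dc; rewrite -(new_root_target Dc).
Qed.

Lemma merge_edge_outside_tree D : D \in cl ->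
  edge_of (merge_edge D) \notin tree s.
Proof.
case/merge_outgoing=> /outgoingP[_ _ ne] _ _ _; apply: contra ne.
by have [_ _ _ adjR /adjR ->] := vs.
Qed.

(* Every message is handled but the one sent by the smaller cluster of a mutual
   pair, and the edges of both messages of such a pair coincide. *)
Lemma round_valid cur :
  tree cur = merged [set D in cl | ~~ small D] ->
  {in nodes G, forall x, root cur x = new_root (root s x)} ->
  valid_forest cur.
Proof.
set X := [set D in cl | _] => tE rE.
have Xc : X \subset cl by apply/subsetP=> D; rewrite inE => /andP[].
have cE D : D \in cl -> edge_of (merge_edge D) \in tree cur.
  move=> Dc; rewrite tE; case: (boolP (small D)) => sD; last first.
    by apply: merge_edge_merged; rewrite inE Dc.
  case/andP: (sD) => /eqP DD lt; rewrite -(mutual_edge Dc DD) merge_edge_merged //.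
  by rewrite inE target_cluster //= /small DD negb_and -leqNgt ltnW // orbT.
have [_ _ rootP _] := vs.
split; first by rewrite tE merged_edges.
- by rewrite tE; exact: merged_safe.
- move=> x xG; rewrite rE //; have [rN xr] := rootP x xG.
  have rc := root_cluster xG; have [rn _] := new_root_small rc.
  have inC u v : connect (adj (tree s)) u v -> connect (adj (tree cur)) u v.
    by apply: conn_subset; rewrite tE subsetUl.
  have iterC k : connect (adj (tree cur)) (root s x) (iter k target (root s x)).
    elim: k => [|k IHk]; first exact: connect0.
    have kc := iter_target_cluster k rc; have [o r1 _ _] := merge_outgoing kc.
    have [n1 n2 _] := outgoingP o; have [_ /inC c1] := rootP _ n1.
    have [_ /inC c2] := rootP _ n2; apply: connect_trans IHk _.
    apply: connect_trans c2; rewrite r1 conn_sym in c1; apply: connect_trans c1 _.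
    by apply: connect1; exact: cE.
  split; last by apply: connect_trans (inC _ _ xr) _; rewrite -(iter_findex rn).
  by apply: cluster_node; rewrite -(iter_findex rn); exact: iter_target_cluster.
- move=> x y xy; have xyG : [set x; y] \in edges G.
    by apply: subsetP (merged_edges Xc) _ _; rewrite -tE.
  have [_ xG yG] := edgeP wfG xyG; rewrite !rE //.
  by apply: merged_root Xc _; rewrite -tE.
Qed.

End OneRound.

(** * Executions: invariant, progress and termination *)

Section Execution.
Variables (V : finType) (R : realType) (G : wgraph V R) (id : V -> nat).
Hypothesis wfG : well_formed G.
Hypothesis id_inj : {in nodes G &, injective id}.
Hypothesis connG : connected_graph G.
Implicit Types (s cur : forest V) (moe : V -> V * V) (M P : {set V}).

(** Small clusters are left out because their messages are dropped without adding an edge. *)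
Definition handled s moe P : {set V} :=
  [set D in clusters G s :\: P | ~~ small G id s moe D].

(** [inv_outgoing] ensures that the round adds an edge, for termination; [inv_modified] gives
    broadcasts their starting nodes, for progress; [inv_root] makes the final roots independent of
    the order of messages. *)
Record merging_inv s moe cur M P : Prop := MergingInv {
  inv_valid : valid_forest G s;
  inv_outgoing : exists p, outgoing G s p;
  inv_moe : forall r, r \in clusters G s -> is_moe G id s r (moe r);
  inv_pending : P \subset clusters G s;
  inv_tree : tree cur = merged G id s moe (handled s moe P);
  inv_modified : forall D, D \in handled s moe P ->
    (merge_edge G id s moe D).1 \in M /\ (merge_edge G id s moe D).2 \in M;
  inv_root : forall x, x \in M -> root cur x = new_root G id s moe (root s x)
}.

Definition config_inv (c : config V) : Prop :=
  match c with
  | RoundStart s => valid_forest G s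
  | Merging s moe cur M P => merging_inv s moe cur M P
  | Terminated T => is_mst G T
  end.

Lemma handled_clusters s moe P : handled s moe P \subset clusters G s.
Proof. by apply/subsetP=> D; rewrite !inE => /andP[/andP[]]. Qed.

Lemma handled_small s moe P j : small G id s moe j ->
  handled s moe (P :\ j) = handled s moe P.
Proof.
move=> sj; apply/setP=> D; rewrite !inE; case: (eqVneq D j) => [->|] //=.
by rewrite sj !andbF.
Qed.

Lemma handled_setD1 s moe P j : j \in clusters G s -> ~~ small G id s moe j ->
  handled s moe (P :\ j) = j |: handled s moe P.
Proof.
move=> jc sj; apply/setP=> D; rewrite !inE; case: (eqVneq D j) => [->|] //=.
by rewrite jc sj.
Qed.

Lemma no_outgoing_connected s : valid_forest G s ->
  (forall p, ~~ outgoing G s p) -> connected_on (nodes G) (tree s).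
Proof.
move=> [_ _ rootP _] no x y xG yG.
have E : root s x = root s y.
  apply: (connect_stable (P := fun z => root s x = root s z) _ (connG xG yG)) => //.
  move=> u v uv ->; apply/eqP; have := no (u, v).
  by rewrite /outgoing (uv : _ \in edges G) negbK.
have [_ xr] := rootP x xG; have [_ yr] := rootP y yG.
by apply: connect_trans xr _; rewrite E conn_sym.
Qed.

Lemma merging_inv_add s moe cur M M' P j cur' :
  merging_inv s moe cur M P -> j \in P ->
  ~~ small G id s moe j ->
  tree cur' = edge_of (merge_edge G id s moe j) |: tree cur ->
  M \subset M' -> (merge_edge G id s moe j).1 \in M' ->
  (merge_edge G id s moe j).2 \in M' ->
  (forall x, x \in M' -> root cur' x = new_root G id s moe (root s x)) ->
  merging_inv s moe cur' M' (P :\ j).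
Proof.
case=> vs oG moeP Pc tE modP _ jP sj tE' /subsetP MM' j1 j2 rE.
have jc := subsetP Pc _ jP.
split=> //; first exact: subset_trans (subD1set _ _) Pc.
- by rewrite tE' tE handled_setD1 // /merged imsetU1 setUCA.
- move=> D; rewrite handled_setD1 // => /setU1P[->|/modP[D1 D2]] //.
  by split; apply: MM'.
Qed.

Lemma step_inv c c' : step G id c c' -> config_inv c -> config_inv c'.
Proof.
case=> {c c'} /=.
- move=> s no vs; have cT := no_outgoing_connected vs no.
  by case: vs => sG sT _ _; apply: safe_connected_mst.
- move=> s moe oG moeP vs; have H0 : handled s moe (clusters G s) = set0.
    by apply/setP=> D; rewrite !inE andNb.
  split=> //; first by rewrite H0 /merged imset0 setU0.
  + by move=> D; rewrite H0 inE.
  + by move=> x; rewrite inE.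
- move=> s moe cur M P i j a b jP mE tj ti lt inv.
  have [vs oG moeP Pc tE modP rE] := inv; have jc := subsetP Pc _ jP.
  have [_ rj tc _] := merge_outgoing wfG id_inj vs moeP jc.
  rewrite tj in tc; rewrite mE /= in rj.
  have ra : root s a = i by rewrite -tj /merge_target mE.
  have si : small G id s moe i by rewrite /small ti tj eqxx lt.
  have ni := new_root_of_small wfG id_inj vs moeP tc si.
  apply: (merging_inv_add inv jP); rewrite ?mE ?inE ?eqxx ?orbT ?subsetUl //.
  + by rewrite /small tj ti eqxx -leqNgt ltnW.
  + by rewrite /= [edge_of _]setUC.
  + have nj : new_root G id s moe j = i.
      by rewrite -ni -tj (new_root_target wfG id_inj vs moeP jc).
    move=> x /=; rewrite !inE; case: ifP => [/orP[]/eqP-> _|nx].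
    * by rewrite ra.
    * by rewrite rj.
    * by rewrite orbF; exact: rE.
- move=> s moe cur M P i j jP tj ti lt inv.
  have [vs oG moeP Pc tE modP rE] := inv; have jc := subsetP Pc _ jP.
  have sj : small G id s moe j by rewrite /small tj ti eqxx lt.
  split; rewrite ?handled_small //.
  exact: subset_trans (subD1set _ _) Pc.
- move=> s moe cur M P i j a b jP mE tj ti aM inv.
  have [vs oG moeP Pc tE modP rE] := inv; have jc := subsetP Pc _ jP.
  have [_ rj tc _] := merge_outgoing wfG id_inj vs moeP jc.
  rewrite mE /= in rj.
  have ra : root s a = i by rewrite -tj /merge_target mE.
  apply: (merging_inv_add inv jP); rewrite ?mE ?setU11 ?subsetUr //.
  + by rewrite /small tj; have /eqP/negPf -> := ti.
  + by rewrite /= [edge_of _]setUC.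
  + by rewrite inE aM orbT.
  + move=> x /=; rewrite !inE; case: eqP => [-> _|_]; last exact: rE.
    by rewrite rE // ra rj -tj (new_root_target wfG id_inj vs moeP jc).
- move=> s moe cur M P x y xM yM xy [vs oG moeP Pc tE modP rE].
  split=> //=; first by move=> D /modP[D1 D2]; rewrite !inE D1 D2 !orbT.
  move=> z; rewrite !inE; case: eqP => [-> _|_]; last exact: rE.
  rewrite rE //; apply: merged_root (handled_clusters s moe P) _ => //.
  by rewrite -tE.
- move=> s moe cur M GM [vs oG moeP Pc tE modP rE].
  apply: (round_valid wfG id_inj vs moeP).
    by rewrite tE /handled setD0.
  by move=> x xG; apply: rE; exact: subsetP xG.
Qed.

Lemma round_start_progress s : valid_forest G s ->
  exists c', step G id (RoundStart s) c'.
Proof.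
move=> vs; case: (boolP [exists p, outgoing G s p]) => [/existsP oG|]; last first.
  rewrite negb_exists => /forallP no; exists (Terminated (tree s)).
  exact: step_terminate.
suff /fin_all_exists[moe moeP] r : exists q, r \in clusters G s -> is_moe G id s r q.
  by exists (Merging s moe s set0 (clusters G s)); apply: step_select.
case: (boolP (r \in clusters G s)) => [rc|_]; last by exists (r, r).
suff [p op rp] : exists2 p, outgoing G s p & root s p.1 = r.
  by have [q mq] := is_moe_exists id op rp; exists q.
have [p op] := oG; have [n1 n2 ne] := outgoingP wfG op.
(* The ends of an outgoing edge have different roots, so one of them is outside [r]; a walk to it
   from inside leaves the cluster. *)
have [z zG rz] : exists2 z, z \in nodes G & root s z != r.
  case: (eqVneq (root s p.1) r) => [E|]; last by exists p.1.
  by exists p.2 => //; rewrite -E eq_sym.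
have /imsetP[x xG rE] := rc.
have xA : x \in [set z | root s z == r] by rewrite inE rE.
have zA : z \notin [set z | root s z == r] by rewrite inE.
have [u [v [uA vA uv]]] := connect_exit (connG xG zG) xA zA.
rewrite !inE in uA vA; exists (u, v); last exact/eqP.
by rewrite /outgoing (uv : _ \in edges G) (eqP uA) eq_sym.
Qed.

Lemma merging_progress s moe cur M P : merging_inv s moe cur M P ->
  exists c', step G id (Merging s moe cur M P) c'.
Proof.
move=> [vs oG moeP Pc tE modP rE].
pose f := merge_target G id s moe.
have fc D : D \in clusters G s -> f D \in clusters G s.
  exact: (target_cluster wfG id_inj vs moeP).
(* A pending message within a mutual pair can be handled at once; the ids decide between merging and
   dropping. *)
case: (boolP [exists j in P, f (f j) == j]) => [/exists_inP[j jP /eqP ffj]|].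
  have jc := subsetP Pc _ jP.
  have [_ _ tc tj] := merge_outgoing wfG id_inj vs moeP jc.
  have [lt|gt|/(cluster_id_inj id_inj vs tc jc)/eqP] := ltngtP (id (f j)) (id j).
  - case mE: (merge_edge G id s moe j) => [b a].
    by eexists; apply: (step_merge_mutual _ _ jP mE (erefl (f j))).
  - by eexists; apply: (step_drop_mutual _ _ jP (erefl (f j))).
  - by rewrite (negPf tj).
rewrite negb_exists => /forallP nomut.
case: (boolP [exists x in M, exists y, (y \notin M) && adj (tree cur) x y]).
  case/exists_inP=> x xM /existsP[y /andP[yM xy]].
  by eexists; apply: (step_broadcast _ _ _ _ _ xM yM xy).
move=> nobr; have closedM x y : connect (adj (tree s)) x y -> x \in M -> y \in M.
  move=> xy xM; apply: contraR nobr => yM.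
  have [u [v [uM vM uv]]] := connect_exit xy xM yM.
  apply/exists_inP; exists u => //; apply/existsP; exists v; rewrite vM /=.
  by rewrite /adj tE (subsetP (subsetUl _ _)).
have [_ _ rootP _] := vs.
have inM D x : D \in clusters G s -> D \notin P -> x \in nodes G ->
    root s x = D -> x \in M.
  move=> Dc DP xG rx.
  suff [z [zM zG rz]] : exists z, [/\ z \in M, z \in nodes G & root s z = D].
    have [_ zr] := rootP z zG; have [_ xr] := rootP x xG.
    by apply: closedM zM; apply: connect_trans zr _; rewrite rz -rx conn_sym.
  have [oD rD _ _] := merge_outgoing wfG id_inj vs moeP Dc.
  case: (boolP (small G id s moe D)) => sD; last first.
    have [|D1 _] := modP D; first by rewrite !inE DP Dc.
    by have [n1 _ _] := outgoingP wfG oD; exists (merge_edge G id s moe D).1.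
  (* The partner of a small [D] is not pending either, and its handled message ended at a node of
     [D]. *)
  case/andP: sD => /eqP DD lt; have tc := fc D Dc.
  have [ot _ _ _] := merge_outgoing wfG id_inj vs moeP tc.
  have tP : f D \notin P.
    by apply/negP=> tP; have := nomut (f D); rewrite tP /f DD eqxx.
  have [|_ D2] := modP (f D).
    by rewrite !inE tP tc /= /small /f DD negb_and -leqNgt ltnW // orbT.
  have [_ n2 _] := outgoingP wfG ot.
  by exists (merge_edge G id s moe (f D)).2.
case: (set_0Vmem P) => [P0|[j0 j0P]].
  subst P; eexists; apply: step_next_round; apply/subsetP=> x xG.
  by apply: (inM (root s x)); rewrite ?inE ?root_cluster.
(* Otherwise [P] would be closed under [f] and would contain a member of a mutual pair. *)
have [j jP fjP] : exists2 j, j \in P & f j \notin P.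
  apply/exists_inP; apply: contraT; rewrite negb_exists => /forallP allP.
  have fP D : D \in P -> f D \in P.
    by move=> DP; have := allP D; rewrite DP /= negbK.
  have [k kE] := reaches_mutual wfG id_inj vs moeP (subsetP Pc _ j0P).
  have kP : iter k f j0 \in P by elim: k {kE} => //= k; exact: fP.
  by have := nomut (iter k f j0); rewrite kP /= /f kE eqxx.
have jc := subsetP Pc _ jP.
have [oj _ tc _] := merge_outgoing wfG id_inj vs moeP jc.
have [_ n2 _] := outgoingP wfG oj.
have aM := inM (f j) _ tc fjP n2 erefl.
case mE: (merge_edge G id s moe j) aM => [b a] aM.
eexists; apply: (step_merge_forward _ jP mE (erefl (f j)) _ aM).
by have := nomut j; rewrite jP /= => /eqP.
Qed.

(* Every round adds an edge to the tree; within a round, every step handles a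
   message or spreads the modify messages to a new node. *)
Definition measure (c : config V) : nat :=
  match c with
  | RoundStart s => #|~: tree s| * #|V|.*2.+2 + 1
  | Merging s _ _ M P => #|~: tree s|.-1 * #|V|.*2.+2 + #|P| + #|~: M| + 2
  | Terminated _ => 0
  end.

Lemma cardsC_lt (T : finType) (A B : {set T}) x :
  A \subset B -> x \in B -> x \notin A -> #|~: B| < #|~: A|.
Proof.
move=> AB xB xA; apply: proper_card; rewrite properE setCS AB /=.
by apply/subsetPn; exists x; rewrite inE ?negbK.
Qed.

Lemma step_measure c c' : config_inv c -> step G id c c' -> measure c' < measure c.
Proof.
move=> inv cc'; case: cc' inv => {c c'} /=.
- by move=> s _ _; rewrite addn1.
- move=> s moe [p op] _ [_ _ _ adjR].
  (* An outgoing edge is not in the tree, so the predecessor taken in the measure is a true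
     decrement. *)
  have lt : 0 < #|~: tree s|.
    apply/card_gt0P; exists (edge_of p); rewrite inE; apply/negP=> /adjR E.
    by case/andP: op => _; rewrite E eqxx.
  (* The two cardinals and the summand 2 fit into the one block [#|V|.*2.+2] given up; the summand 1
     makes the decrease strict. *)
  have cV (A : {set V}) : #|A| <= #|V| by exact: max_card.
  have := cV (clusters G s); have := cV (~: set0).
  rewrite -{2}(prednK lt) mulSn.
  by move: #|clusters G s| #|~: set0| #|V| (_ * _) => k l n m; lia.
- move=> s moe cur M P i j a b jP _ _ _ _ _; have := cardsD1 j P; rewrite jP.
  have : #|~: (M :|: [set a; b])| <= #|~: M| by rewrite subset_leq_card ?setCS ?subsetUl.
  by rewrite add1n; lia.
- by move=> s moe cur M P i j jP _ _ _ _; have := cardsD1 j P; rewrite jP; lia.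
- move=> s moe cur M P i j a b jP _ _ _ _ _; have := cardsD1 j P; rewrite jP.
  have : #|~: (b |: M)| <= #|~: M| by rewrite subset_leq_card ?setCS ?subsetUr.
  by rewrite add1n; lia.
- move=> s moe cur M P x y _ yM _ _.
  by have := @cardsC_lt _ M (y |: M) y (subsetUr _ _) (setU11 _ _) yM; lia.
- move=> s moe cur M GM [vs [p op] moeP _ tE _ _].
  have [n1 _ _] := outgoingP wfG op; have Dc := root_cluster s n1.
  have [_ _ tc tj] := merge_outgoing wfG id_inj vs moeP Dc.
  (* If a cluster is small, its mutual partner is not; so some message has added a new edge. *)
  have [D [Dc' sD]] : exists D, D \in clusters G s /\ ~~ small G id s moe D.
    set D := root s p.1 in Dc tc tj *.
    case: (boolP (small G id s moe D)) => sD; last by exists D.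
    exists (merge_target G id s moe D); split=> //; case/andP: sD => /eqP DD lt.
    by rewrite /small DD negb_and -leqNgt (ltnW lt) orbT.
  have : #|~: tree cur| < #|~: tree s|.
    apply: (@cardsC_lt _ _ _ (edge_of (merge_edge G id s moe D))).
    - by rewrite tE subsetUl.
    - by rewrite tE merge_edge_merged // !inE Dc' sD.
    - exact: (merge_edge_outside_tree wfG id_inj vs moeP Dc').
  move=> lt; have le : #|~: tree cur| <= #|~: tree s|.-1 by lia.
  rewrite addn1 addn2 !ltnS -addnA.
  exact: leq_trans (leq_mul le (leqnn _)) (leq_addr _ _).
Qed.

Lemma reachable_inv c c' : reachable G id c c' -> config_inv c -> config_inv c'.
Proof.
by elim=> {c c'} [c c' /step_inv||c c' c'' _ IH1 _ IH2 /IH1/IH2].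
Qed.

Lemma no_infinite_run c : config_inv c ->
  ~ exists run : nat -> config V,
      run 0 = c /\ forall t, step G id (run t) (run t.+1).
Proof.
move=> invc [run [run0 stepR]].
have inv t : config_inv (run t).
  by elim: t => [|t]; [rewrite run0|apply: step_inv].
have dec t : measure (run t) + t <= measure (run 0).
  elim: t => [|t IHt]; first by rewrite addn0.
  by rewrite addnS -addSn (leq_trans _ IHt) // leq_add2r step_measure.
by have := dec (measure (run 0)).+1; rewrite addnS ltnNge leq_addl.
Qed.

Lemma config_progress c : config_inv c ->
  (exists c', step G id c c') \/ exists T, c = Terminated T.
Proof.
case: c => [s /round_start_progress|s moe cur M P /merging_progress|T _]; auto.
by right; exists T.
Qed.

End Execution.

(** * The forest left by deleting the faulty node *)

Section InitialForest.
Variables (V : finType) (R : realType) (G : wgraph V R).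
Hypothesis wfG : well_formed G.

Lemma delete_node_well_formed v : well_formed (delete_node G v).
Proof.
move=> e; rewrite inE => /andP[/wfG[eG e2 we] ve]; split=> //.
apply/subsetP=> x xe; rewrite !inE (subsetP eG) // andbT.
by apply: contraNneq ve => <-.
Qed.

Lemma initial_forest_valid T v : is_mst G T -> v \in nodes G ->
  valid_forest (delete_node G v) (initial_forest T v).
Proof.
move=> mstT vG; have [[TG cT _] _] := mstT.
set G' := delete_node G v; pose F := [set e in T | v \notin e].
have FT : F \subset T by apply/subsetP=> e; rewrite inE => /andP[].
have FG : F \subset edges G'.
  by apply/subsetP=> e; rewrite !inE => /andP[/(subsetP TG) -> ->].
have rootP x : x \in nodes G' ->
    adj T v (root (initial_forest T v) x) /\
    connect (adj F) (root (initial_forest T v) x) x.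
  rewrite !inE => /andP[xv xG] /=; case: pickP => [r /andP[]//|none].
  (* On a walk in [T] from [v], the witness [r] is the node following the last visit to [v]. *)
  pose Q z := z = v \/ exists2 r, adj T v r & connect (adj F) r z.
  have : Q x.
    apply: (connect_stable _ (cT v x vG xG)); last by left.
    move=> u w uw Qu; case: (eqVneq w v) => [->|wv]; first by left.
    right; case: (eqVneq u v) Qu => [uv _|uv [E|[r vr ru]]].
    - by exists w; rewrite -?uv ?connect0.
    - by rewrite E eqxx in uv.
    exists r => //; apply: connect_trans ru (connect1 _).
    by rewrite /adj !inE (uw : _ \in T) eq_sym (negPf uv) eq_sym (negPf wv).
  case=> [E|[r vr rx]]; first by rewrite E eqxx in xv.
  by have := none r; rewrite vr rx.
split=> //=.
(* Deleting [v] only removes edges from [G], so no rivals are gained. *)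
- have sT := mst_safe wfG mstT.
  have sF := safe_subset FT sT.
  move=> x y xyF; apply: contra (sF x y xyF); apply: conn_subset.
  apply/subsetP=> g; rewrite !inE.
  by case/orP=> [/andP[/andP[-> _] ->]//|->]; rewrite orbT.
- move=> x xG; have [vr rx] := rootP x xG; split; last by rewrite conn_sym.
  have [ne _ rG] := edgeP wfG (subsetP TG _ vr).
  by rewrite !inE rG eq_sym ne.
- move=> x y xy; have xyG := subsetP FG _ xy.
  have [_ xG yG] := edgeP (@delete_node_well_formed v) xyG.
  have := rootP x xG; have := rootP y yG => /=.
  (* Adjacent nodes offer [pick] the same candidates and hence get the same root. *)
  have E r : adj T v r && connect (adj F) r x = adj T v r && connect (adj F) r y.
    congr (_ && _); apply: (same_connect_r (sym_connect_sym (@adj_sym _ F))).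
    exact: connect1.
  rewrite -(eq_pick E); case: pickP => // none [vy ry] _.
  by have := none y; rewrite E vy ry.
Qed.

End InitialForest.

Theorem theorem2 (V : finType) (R : realType) (Gc : wgraph V R) (id : V -> nat)
    (Ta : {set {set V}}) (vf : V) :
  well_formed Gc ->
  connected_graph Gc ->
  {in nodes Gc &, injective id} ->
  is_mst Gc Ta ->
  vf \in nodes Gc ->
  connected_graph (delete_node Gc vf) ->
  let Gc' := delete_node Gc vf in
  let start := RoundStart (initial_forest Ta vf) in
  [/\ (* every execution is finite *)
      ~ (exists run : nat -> config V,
           run 0 = start /\ forall t, step Gc' id (run t) (run t.+1)),
      (* no execution blocks before termination *)
      forall c, reachable Gc' id start c ->
        (exists c', step Gc' id c c') \/ (exists Ta', c = Terminated Ta')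
    & (* every output is a minimum spanning tree of the reduced graph *)
      forall Ta', reachable Gc' id start (Terminated Ta') -> is_mst Gc' Ta'].
Proof.
move=> wfG _ idI mst vG cG' Gc' start.
have wfG' : well_formed Gc' by exact: delete_node_well_formed.
have idI' : {in nodes Gc' &, injective id}.
  by move=> x y; rewrite !inE => /andP[_ xG] /andP[_ yG]; exact: idI.
have inv0 : config_inv Gc' id start := initial_forest_valid wfG mst vG.
have inv c : reachable Gc' id start c -> config_inv Gc' id c.
  by move=> rc; apply: (reachable_inv wfG' idI' cG' rc).
split; first exact: (no_infinite_run wfG' idI' cG' inv0).
- by move=> c /inv; exact: (config_progress wfG' idI' cG').
- by move=> Ta' /inv.
Qed.
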